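(* Let $n\geq 5$ and $x,y,z,a>0$, and suppose $a\leq\min\{x,y,z\}$. If none of the following holds: (i) $a<y<x<z$ and $y<1$; (ii) $a<z<x<y$ and $1<x$; (iii) $a\leq x<1<\min\{y,z\}$, then the Perron eigenvector of $Z_n(x,y,z,a)$ is efficient for $Z_n(x,y,z,a)$.
   Context: $Z_n(x,y,z,a)$ is the $n\times n$ matrix all of whose entries equal $1$ except: entry $(1,n-1)=y$, $(1,n)=x$, $(2,n-1)=a$, $(2,n)=z$, and $(n-1,1)=1/y$, $(n,1)=1/x$, $(n-1,2)=1/a$, $(n,2)=1/z$. It is a reciprocal matrix. The Perron eigenvector is the positive eigenvector associated with the largest eigenvalue, normalized to have first component $1$. A positive vector $w$ is efficient for a reciprocal matrix $A=[a_{ij}]$ if there is no other positive vector $w'$ with $|a_{ij}-w'_i/w'_j|\leq|a_{ij}-w_i/w_j|$ for all $i,j$ with strict inequality for at least one pair $(i,j)$. *)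

(* Defs.v *)
(* Mathematical Components world. *)
From HB Require Import structures.
From mathcomp Require Export all_boot all_order all_algebra.
From mathcomp Require Export reals complex.

Set Implicit Arguments.
Unset Strict Implicit.
Unset Printing Implicit Defensive.

Import Order.TTheory GRing.Theory Num.Theory.

Local Open Scope ring_scope.
Local Open Scope complex_scope.

(* The 1-based positions of rows and columns are [i.+1] and [j.+1]. *)
Definition Zmx (R : realType) (n : nat) (x y z a : R) : 'M[R]_n :=
  \matrix_(i, j)
    let pos := (i.+1, j.+1) in
    if pos == (1, n.-1)%N then y
    else if pos == (1, n)%N then x
    else if pos == (2, n.-1)%N then a
    else if pos == (2, n)%N then z
    else if pos == (n.-1, 1)%N then y^-1
    else if pos == (n, 1)%N then x^-1
    else if pos == (n.-1, 2)%N then a^-1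
    else if pos == (n, 2)%N then z^-1
    else 1.

Definition positive_vector (R : realType) (n : nat) (w : 'cV[R]_n) : Prop :=
  forall i, 0 < w i 0.

(* The Perron eigenvalue: a real eigenvalue that bounds the modulus of every
   complex eigenvalue.  The library's [eigenvalue] is defined through row
   vectors; a square matrix and its transpose have the same eigenvalues. *)
Definition largest_eigenvalue (R : realType) (n : nat) (A : 'M[R]_n) (r : R)
    : Prop :=
  eigenvalue A r /\
  forall mu : R[i],
    eigenvalue (map_mx (real_complex R) A) mu -> `|mu| <= r%:C.

(* Perron eigenvectors are right (column) eigenvectors. *)
Definition perron_eigenvector (R : realType) (n : nat) (A : 'M[R]_n)
    (w : 'cV[R]_n) : Prop :=
  [/\ positive_vector w,
      exists2 r : R, largest_eigenvalue A r & A *m w = r *: w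
    & forall i : 'I_n, i = 0%N :> nat -> w i 0 = 1].

Definition efficient (R : realType) (n : nat) (A : 'M[R]_n) (w : 'cV[R]_n)
    : Prop :=
  positive_vector w /\
  ~ (exists w' : 'cV[R]_n,
      [/\ positive_vector w',
          forall i j, `|A i j - w' i 0 / w' j 0| <= `|A i j - w i 0 / w j 0|
        & exists i j, `|A i j - w' i 0 / w' j 0| < `|A i j - w i 0 / w j 0|]).

(* Main.v *)
Require Import Defs.
From mathcomp Require Import ring lra zify.
Import Order.TTheory GRing.Theory Num.Theory.
Local Open Scope ring_scope.

(** Draw an edge from i to j when [w i >= A i j * w j].  If [w'] is at least as
    good as [w] everywhere, then [w' i / w i <= w' j / w j] along every edge, so
    [w] is efficient as soon as no cut of the vertices has all its edges running
    one way.

    For [Z_n] the middle entries of the Perron vector are all equal, so a cut is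
    determined by five booleans, for the entries [u1], [u2] (first two), [c]
    (middle), [v1] and [v2] (last two).
    Every difference [w i - A i j * w j] is, up to a positive factor, a
    nonnegative combination of two or three differences of [x], [y], [z], [a]
    and 1.  A cut prescribes the signs of these differences, hence gives order
    constraints on the parameters, which are contradictory outside (i)-(iii)
    except for four cuts.  Two of these would make [u1] or [v2] a source of the
    graph, which is impossible because the Perron eigenvalue is at least [n] by
    AM-GM; the other two need a quantitative argument. *)

(** * Order constraints on the parameters imposed by a cut *)

(* [true] marks the side of the cut with the smaller values. *)
Definition cut {R : realFieldType} (p q : bool) (u v : R) : Prop :=
  match p, q with
  | true, false => u < v
  | false, true => v < u
  | _, _ => True
  end.

(** What [cut] forces when [u - v] is, up to a positive factor, a nonnegative combination of [A],
    [B], [C]. A slot filled with 0 adds an impossible alternative. *)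
Definition cut_signs {R : realFieldType} (p q : bool) (A B C : R) : Prop :=
  match p, q with
  | true, false => [\/ A < 0, B < 0 | C < 0]
  | false, true => [\/ 0 < A, 0 < B | 0 < C]
  | _, _ => True
  end.

Lemma pos_comb3 {R : realFieldType} {K d A B C s t r : R} :
    0 < K -> 0 <= s -> 0 <= t -> 0 <= r ->
    K * d = A * s + B * t + C * r -> 0 < d ->
  [\/ 0 < A, 0 < B | 0 < C].
Proof.
move=> K_gt0 s_ge0 t_ge0 r_ge0 eqd d_gt0.
have [A_gt0|A_le0] := ltrP 0 A; first by constructor 1.
have [B_gt0|B_le0] := ltrP 0 B; first by constructor 2.
have [C_gt0|C_le0] := ltrP 0 C; first by constructor 3.
have : 0 < K * d by rewrite mulr_gt0.
have := mulr_le0_ge0 A_le0 s_ge0; have := mulr_le0_ge0 B_le0 t_ge0.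
have := mulr_le0_ge0 C_le0 r_ge0; lra.
Qed.

Lemma cut_signsP {R : realFieldType} {p q : bool} {K u v A B C s t r : R} :
    0 < K -> 0 <= s -> 0 <= t -> 0 <= r ->
    K * (u - v) = A * s + B * t + C * r -> cut p q u v ->
  cut_signs p q A B C.
Proof.
move=> K_gt0 s_ge0 t_ge0 r_ge0 eqd; case: p; case: q => //= uv.
- have eqd' : K * (v - u) = - A * s + - B * t + - C * r.
    by rewrite -opprB mulrN eqd; ring.
  rewrite -!oppr_gt0; apply: pos_comb3 eqd' _ => //; lra.
- by apply: pos_comb3 eqd _ => //; lra.
Qed.

(** Depth-bounded search for a chain of hypotheses; at a dead end [match goal] tries another one. *)
Ltac le_path d :=
  match goal with
  | |- is_true (?u <= ?u) => exact: lexx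
  | H : is_true (?u <= ?v) |- is_true (?u <= _) =>
      match d with S ?d' => apply: (le_trans H); le_path d' end
  | H : is_true (?u < ?v) |- is_true (?u <= _) =>
      match d with S ?d' => apply: (le_trans (ltW H)); le_path d' end
  end.

Ltac lt_cycle :=
  match goal with
  | H : is_true (?u < ?v) |- False =>
      move: H; rewrite ltNge => /negP; apply; le_path 4%N
  end.

Ltac split_lt H :=
  case: H => H; try first [by rewrite ltxx in H | lt_cycle].

(* [e] stands for 1: with a variable, all occurrences match syntactically in
   [lt_cycle]. *)
Lemma cut_signs_cases {R : realFieldType} {e x y z a : R}
    {p1 p2 pc p3 p4 : bool} :
    a <= x -> a <= y -> a <= z ->
    ~ [/\ a < y, y < x, x < z & y < e] ->
    ~ [/\ a < z, z < x, x < y & e < x] ->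
    ~ [/\ a <= x, x < e & e < Num.min y z] ->
    cut_signs p1 pc (y - e) (x - e) 0 ->
    cut_signs p2 pc (a - e) (z - e) 0 ->
    cut_signs p3 pc (e - y) (e - a) 0 ->
    cut_signs p4 pc (e - x) (e - z) 0 ->
    cut_signs p1 p2 (y - a) (x - z) 0 ->
    cut_signs p3 p4 (x - y) (z - a) 0 ->
    cut_signs p1 p4 (z - x) (e - x) (y - x) ->
    cut_signs p1 p3 (a - y) (e - y) (x - y) ->
    cut_signs p2 p3 (y - a) (e - a) (z - a) ->
    cut_signs p2 p4 (x - z) (e - z) (a - z) ->
  (p1, p2, pc, p3, p4) \in
    [:: (true, true, true, true, true); (false, false, false, false, false);
        (true, true, false, true, false); (false, true, false, true, true);
        (false, true, true, true, true); (true, true, true, true, false)].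
Proof.
move=> ax ay az; rewrite lt_min.
move=> /and4P; rewrite !negb_and -!leNgt => n1.
move=> /and4P; rewrite !negb_and -!leNgt => n2.
move=> /and3P; rewrite !negb_and -!leNgt -ltNge => n3.
move: n1 => /or4P n1; move: n2 => /or4P n2; move: n3 => /or4P n3.
case: p1; case: p2; case: pc; case: p3; case: p4 => //=;
  move=> s1 s2 s3 s4 s5 s6 s7 s8 s9 s10;
  exfalso;
  rewrite ?subr_lt0 ?subr_gt0 in s1 s2 s3 s4 s5 s6 s7 s8 s9 s10.
(* In each of the 26 cuts off the list, every choice of alternatives closes a cycle with a strict
   inequality. The exclusions (i), (ii), (iii), here [n1], [n2], [n3], serve in two cuts each. *)
- by split_lt s9; split_lt s3.
- by split_lt s9; split_lt s3.
- by split_lt s1; split_lt s3; split_lt n3; split_lt s4.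
- by split_lt s9; split_lt s1.
- by split_lt s9; split_lt s1.
- by split_lt s5; split_lt s10; split_lt s2.
- by split_lt s2; split_lt s4; split_lt s6; split_lt s7.
- by split_lt s5; split_lt s10; split_lt s2.
- by split_lt s2; split_lt s4; split_lt s7; split_lt n1; split_lt s8.
- by split_lt s5; split_lt s10; split_lt s4.
- by split_lt s1; split_lt s3; split_lt s5; split_lt s7.
- by split_lt s5; split_lt s10; split_lt s4.
- by split_lt s5; split_lt s7; split_lt s1; split_lt n1; split_lt s8.
- by split_lt s6; split_lt s8; split_lt s1.
- by split_lt s9; split_lt s3.
- by split_lt s9; split_lt s3.
- by split_lt s6; split_lt s8; split_lt s3.
- by split_lt s9; split_lt s2.
- by split_lt s9; split_lt s2.
- by split_lt s8; split_lt s1; split_lt s7; split_lt s10.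
- by split_lt s6; split_lt s8; split_lt s1.
- by split_lt s10; split_lt s2; split_lt s3; split_lt s7; split_lt n2.
- by split_lt s2; split_lt s4; split_lt n3; split_lt s1.
- by split_lt s8; split_lt s3; split_lt s7; split_lt s10.
- by split_lt s6; split_lt s8; split_lt s3.
- by split_lt s10; split_lt s4; split_lt s7; split_lt n2; split_lt s6.
Qed.

(** * The five eigenvector equations and the cuts they allow *)

Section ReducedSystem.

Variables (R : realFieldType) (x y z a k lam u1 u2 c v1 v2 : R).
Hypotheses (x_gt0 : 0 < x) (y_gt0 : 0 < y) (z_gt0 : 0 < z) (a_gt0 : 0 < a).
Hypotheses (k_ge0 : 0 <= k) (lam_gt0 : 0 < lam).
Hypotheses (u1_gt0 : 0 < u1) (u2_gt0 : 0 < u2) (c_gt0 : 0 < c).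
Hypotheses (v1_gt0 : 0 < v1) (v2_gt0 : 0 < v2).
Hypothesis eq_u1 : lam * u1 = u1 + u2 + k * c + y * v1 + x * v2.
Hypothesis eq_u2 : lam * u2 = u1 + u2 + k * c + a * v1 + z * v2.
Hypothesis eq_c : lam * c = u1 + u2 + k * c + v1 + v2.
Hypothesis eq_v1 : lam * v1 = u1 / y + u2 / a + k * c + v1 + v2.
Hypothesis eq_v2 : lam * v2 = u1 / x + u2 / z + k * c + v1 + v2.

Let x_neq0 : x != 0. Proof. exact: lt0r_neq0. Qed.
Let y_neq0 : y != 0. Proof. exact: lt0r_neq0. Qed.
Let z_neq0 : z != 0. Proof. exact: lt0r_neq0. Qed.
Let a_neq0 : a != 0. Proof. exact: lt0r_neq0. Qed.
Let kc_ge0 : 0 <= k * c. Proof. by rewrite mulr_ge0 // ltW. Qed.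

(* The terms [0 * 0] give every identity the three-term shape of
   [cut_signsP]. *)
Let diff_u1_c : lam * (u1 - c) = (y - 1) * v1 + (x - 1) * v2 + 0 * 0.
Proof. by rewrite mulrBr eq_u1 eq_c; ring. Qed.

Let diff_u2_c : lam * (u2 - c) = (a - 1) * v1 + (z - 1) * v2 + 0 * 0.
Proof. by rewrite mulrBr eq_u2 eq_c; ring. Qed.

Let diff_v1_c :
  y * a * lam * (v1 - c) = (1 - y) * (a * u1) + (1 - a) * (y * u2) + 0 * 0.
Proof. by rewrite -mulrA mulrBr eq_v1 eq_c; field; apply/andP. Qed.

Let diff_v2_c :
  x * z * lam * (v2 - c) = (1 - x) * (z * u1) + (1 - z) * (x * u2) + 0 * 0.
Proof. by rewrite -mulrA mulrBr eq_v2 eq_c; field; apply/andP. Qed.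

Let diff_u1_u2 : lam * (u1 - u2) = (y - a) * v1 + (x - z) * v2 + 0 * 0.
Proof. by rewrite mulrBr eq_u1 eq_u2; ring. Qed.

Let diff_v1_v2 : x * y * z * a * lam * (v1 - v2) =
  (x - y) * (z * a * u1) + (z - a) * (x * y * u2) + 0 * 0.
Proof.
rewrite -mulrA mulrBr eq_v1 eq_v2; field.
by rewrite x_neq0 y_neq0 z_neq0 a_neq0.
Qed.

Let diff_u1_v2 : z * lam * (u1 - x * v2) =
  (z - x) * u2 + (1 - x) * (z * (k * c)) + (y - x) * (z * v1).
Proof.
rewrite -mulrA mulrBr [lam * (x * _)]mulrCA eq_u1 eq_v2; field.
by apply/andP.
Qed.

Let diff_u1_v1 : a * lam * (u1 - y * v1) =
  (a - y) * u2 + (1 - y) * (a * (k * c)) + (x - y) * (a * v2).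
Proof.
rewrite -mulrA mulrBr [lam * (y * _)]mulrCA eq_u1 eq_v1; field.
by apply/andP.
Qed.

Let diff_u2_v1 : y * lam * (u2 - a * v1) =
  (y - a) * u1 + (1 - a) * (y * (k * c)) + (z - a) * (y * v2).
Proof.
rewrite -mulrA mulrBr [lam * (a * _)]mulrCA eq_u2 eq_v1; field.
by apply/andP.
Qed.

Let diff_u2_v2 : x * lam * (u2 - z * v2) =
  (x - z) * u1 + (1 - z) * (x * (k * c)) + (a - z) * (x * v1).
Proof.
rewrite -mulrA mulrBr [lam * (z * _)]mulrCA eq_u2 eq_v2; field.
by apply/andP.
Qed.

(** Average [(A w)_i / w_i] over all rows, counting [c] with multiplicity [k]. Mutually reciprocal
    entries contribute [t + 1 / t >= 2]; with every such sum replaced by 2 the total is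
    [(4 + k) ^+ 2]. *)
Lemma le_perron : 4 + k <= lam.
Proof.
have k0 := k_ge0.
have amgm (s t : R) : 0 < s -> 0 < t -> 2 <= s / t + t / s.
  move=> s0 t0; rewrite -subr_ge0.
  have -> : s / t + t / s - 2 = (s - t) ^+ 2 / (s * t).
    by field; rewrite !lt0r_neq0.
  by rewrite divr_ge0 ?sqr_ge0 // mulr_ge0 // ltW.
have yv1_gt0 : 0 < y * v1 by rewrite mulr_gt0.
have xv2_gt0 : 0 < x * v2 by rewrite mulr_gt0.
have av1_gt0 : 0 < a * v1 by rewrite mulr_gt0.
have zv2_gt0 : 0 < z * v2 by rewrite mulr_gt0.
have -> : lam = (16 + 8 * k + k ^+ 2 +
  ((u1 / u2 + u2 / u1 - 2) + (u1 / (y * v1) + y * v1 / u1 - 2) +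
   (u1 / (x * v2) + x * v2 / u1 - 2) + (u2 / (a * v1) + a * v1 / u2 - 2) +
   (u2 / (z * v2) + z * v2 / u2 - 2) + (v1 / v2 + v2 / v1 - 2) +
   k * ((u1 / c + c / u1 - 2) + (u2 / c + c / u2 - 2) +
        (v1 / c + c / v1 - 2) + (v2 / c + c / v2 - 2)))) / (4 + k).
  have d1 : lam = (lam * u1) / u1 by rewrite mulfK ?lt0r_neq0.
  have d2 : lam = (lam * u2) / u2 by rewrite mulfK ?lt0r_neq0.
  have dc : lam = (lam * c) / c by rewrite mulfK ?lt0r_neq0.
  have d3 : lam = (lam * v1) / v1 by rewrite mulfK ?lt0r_neq0.
  have d4 : lam = (lam * v2) / v2 by rewrite mulfK ?lt0r_neq0.
  apply: (@mulIf _ (4 + k)); first by apply: lt0r_neq0; lra.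
  rewrite divfK; last by apply: lt0r_neq0; lra.
  transitivity ((lam * u1) / u1 + (lam * u2) / u2 + (lam * v1) / v1
    + (lam * v2) / v2 + k * ((lam * c) / c)).
    by rewrite -d1 -d2 -d3 -d4 -dc; ring.
  rewrite eq_u1 eq_u2 eq_c eq_v1 eq_v2; field.
  by rewrite !lt0r_neq0.
rewrite ler_pdivlMr; last by lra.
have := amgm _ _ u1_gt0 u2_gt0; have := amgm _ _ u1_gt0 yv1_gt0.
have := amgm _ _ u1_gt0 xv2_gt0; have := amgm _ _ u2_gt0 av1_gt0.
have := amgm _ _ u2_gt0 zv2_gt0; have := amgm _ _ v1_gt0 v2_gt0.
move=> h1 h2 h3 h4 h5 h6.
have h7 : 0 <= k * ((u1 / c + c / u1 - 2) + (u2 / c + c / u2 - 2) +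
        (v1 / c + c / v1 - 2) + (v2 / c + c / v2 - 2)).
  apply: mulr_ge0 => //; have := amgm _ _ u1_gt0 c_gt0.
  have := amgm _ _ u2_gt0 c_gt0; have := amgm _ _ v1_gt0 c_gt0.
  by have := amgm _ _ v2_gt0 c_gt0; lra.
set X := k * (_ + _) in h7 *.
have -> : (4 + k) * (4 + k) = 16 + 8 * k + k ^+ 2 by ring.
lra.
Qed.

(** All terms in the row of [u1] would be at most [u1], some strictly smaller, forcing
    [lam < 4 + k]. *)
Lemma u1_not_source : u2 < u1 -> c < u1 -> y * v1 < u1 -> x * v2 < u1 -> False.
Proof.
move=> h1 h2 h3 h4.
have : k * c <= k * u1 by rewrite ler_wpM2l // ltW.
have : (4 + k) * u1 <= lam * u1 by rewrite ler_pM2r // le_perron.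
rewrite eq_u1; lra.
Qed.

Lemma v2_not_source : u1 < x * v2 -> u2 < z * v2 -> c < v2 -> v1 < v2 -> False.
Proof.
move=> h1 h2 h3 h4.
have : k * c <= k * v2 by rewrite ler_wpM2l // ltW.
have : (4 + k) * v2 <= lam * v2 by rewrite ler_pM2r // le_perron.
have : u1 / x < v2 by rewrite ltr_pdivrMr // mulrC.
have : u2 / z < v2 by rewrite ltr_pdivrMr // mulrC.
rewrite eq_v2; lra.
Qed.

(** By [diff_v1_c], [v1 < c] means [(1 - a) * (y * u2) < (y - 1) * (a * u1)]. Together with
    [a * u1 < y * u2] this gives [1 - a < y - 1]. *)
Lemma lt_2subr_y : v1 < c -> a < y -> 1 < y -> a * x <= y * z -> 2 - a < y.
Proof.
have [[u1_0 u2_0] kc0] := (u1_gt0, u2_gt0, kc_ge0).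
move=> v1c ay y1 axyz.
(* [u1 / u2] is a mediant of ratios at most [y / a]. *)
have h1 : a * u1 < y * u2.
  rewrite -subr_gt0 -(pmulr_rgt0 _ lam_gt0).
  have -> : lam * (y * u2 - a * u1) =
      (y - a) * (u1 + u2 + k * c) + (y * z - a * x) * v2.
    by rewrite mulrBr mulrCA eq_u2 mulrCA eq_u1; ring.
  rewrite ltr_wpDr // ?mulr_ge0 ?subr_ge0 ?mulr_gt0 ?subr_gt0 ?(ltW v2_gt0) //.
  lra.
have h2 : y * a * lam * (v1 - c) < 0.
  by rewrite pmulr_rlt0 ?subr_lt0 // !mulr_gt0.
rewrite diff_v1_c in h2.
have h3 : (y - 1) * (a * u1) < (y - 1) * (y * u2) by rewrite ltr_pM2l ?subr_gt0.
have : 0 < (y + a - 2) * (y * u2) by lra.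
by rewrite pmulr_lgt0 ?mulr_gt0 //; lra.
Qed.

(** Add the identities for [u1 - x * v2] and [u2 - z * v2]: the [c] terms are nonnegative, and so is
    the rest in [u1], [u2] because [u2 < u1]. Only the coefficient of [v1] can make the sum
    negative. *)
Lemma no_cut_u1_u2_v1 :
    1 < y -> x < 1 -> z < x -> a <= z ->
    v1 < c -> u1 < x * v2 -> u2 < z * v2 -> False.
Proof.
have [[x0 z0] a0] := (x_gt0, z_gt0, a_gt0).
move=> y_gt1 x_lt1 zx az v1c u1v2 u2v2.
have y_gt : 2 - a < y.
  apply: lt_2subr_y => //; first lra.
  by rewrite [y * z]mulrC; apply: ler_pM; lra.
have u21 : u2 < u1.
  rewrite -subr_gt0 -(pmulr_rgt0 _ lam_gt0) diff_u1_u2 mulr0 addr0.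
  by rewrite addr_gt0 // mulr_gt0 // subr_gt0 //; lra.
have h24 : x * lam * (u2 - z * v2) < 0.
  by rewrite pmulr_rlt0 ?subr_lt0 // mulr_gt0.
have h14 : z * lam * (u1 - x * v2) < 0.
  by rewrite pmulr_rlt0 ?subr_lt0 // mulr_gt0.
rewrite diff_u2_v2 in h24; rewrite diff_u1_v2 in h14.
have g24 : 0 <= (1 - z) * (x * (k * c)).
  by apply: mulr_ge0; [lra | exact: mulr_ge0 (ltW x_gt0) kc_ge0].
have g14 : 0 <= (1 - x) * (z * (k * c)).
  by apply: mulr_ge0; [lra | exact: mulr_ge0 (ltW z_gt0) kc_ge0].
have h12 : (x - z) * u2 < (x - z) * u1 by rewrite ltr_pM2l ?subr_gt0.
have : 0 < ((z - a) * x - (y - x) * z) * v1 by lra.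
rewrite pmulr_lgt0 // => yz_lt.
(* The chain [(2 - a) * z < y * z < x * (2 * z - a) < 2 * z - a] would give [1 < z]. *)
have : (2 - a) * z < y * z by rewrite ltr_pM2r.
have : x * (2 * z - a) < 1 * (2 * z - a) by rewrite ltr_pM2r //; lra.
have : a * z < a * 1 by rewrite ltr_pM2l //; lra.
lra.
Qed.

(** Two opposite bounds on [v1 / v2] arise: [y * v1 < u1] makes it small, [u2 < c] makes it large.
    They force [(y - a) * (z - 1) < (1 - a) * (x - y)], while [2 * (1 - a) < y - a] and
    [x - y < z - 1]. *)
Lemma no_cut_u2_v1_v2 :
    a < 1 -> 1 < y -> y < x -> x < z ->
    v1 < c -> u2 < c -> y * v1 < u1 -> False.
Proof.
have [[y0 a0] v1_0] := (y_gt0, a_gt0, v1_gt0).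
move=> a_lt1 y_gt1 yx xz v1c u2c u1v1.
have y_gt : 2 - a < y.
  apply: lt_2subr_y => //; first lra.
  by apply: ler_pM; lra.
have h13 : 0 < a * lam * (u1 - y * v1).
  by rewrite pmulr_rgt0 ?subr_gt0 // mulr_gt0.
have h2c : lam * (u2 - c) < 0 by rewrite pmulr_rlt0 ?subr_lt0.
have h23 : 0 <= y * lam * (u2 - a * v1).
  rewrite diff_u2_v1.
  have h1 : 0 <= (y - a) * u1 by rewrite mulr_ge0 ?(ltW u1_gt0) //; lra.
  have h2 : 0 <= (1 - a) * (y * (k * c)).
    by apply: mulr_ge0; [lra | exact: mulr_ge0 (ltW y_gt0) kc_ge0].
  have h3 : 0 <= (z - a) * (y * v2).
    by apply: mulr_ge0; [lra | exact: mulr_ge0 (ltW y_gt0) (ltW v2_gt0)].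
  lra.
rewrite diff_u1_v1 in h13; rewrite diff_u2_c in h2c.
have u2v1 : a * v1 <= u2.
  by rewrite -subr_ge0 -(pmulr_rge0 _ (mulr_gt0 y_gt0 lam_gt0)).
have g13 : 0 <= (y - 1) * (a * (k * c)).
  by apply: mulr_ge0; [lra | exact: mulr_ge0 (ltW a_gt0) kc_ge0].
have h1 : (y - a) * (a * v1) <= (y - a) * u2 by rewrite ler_wpM2l //; lra.
have : 0 < a * ((x - y) * v2 - (y - a) * v1) by lra.
rewrite pmulr_rgt0 // => h2.
have h3 : 0 < (1 - a) * ((x - y) * v2 - (y - a) * v1).
  by rewrite mulr_gt0 //; lra.
have h4 : 0 < (y - a) * ((1 - a) * v1 - (z - 1) * v2).
  by rewrite mulr_gt0 //; lra.
have : 0 < ((1 - a) * (x - y) - (y - a) * (z - 1)) * v2 by lra.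
rewrite pmulr_lgt0 // => h5.
have h6 : 2 * (1 - a) * (z - 1) <= (y - a) * (z - 1).
  by rewrite ler_wpM2r //; lra.
have : 0 < (1 - a) * ((x - y) - 2 * (z - 1)) by lra.
by rewrite pmulr_rgt0; lra.
Qed.

Lemma cut_trivial (p1 p2 pc p3 p4 : bool) :
    a <= x -> a <= y -> a <= z ->
    ~ [/\ a < y, y < x, x < z & y < 1] ->
    ~ [/\ a < z, z < x, x < y & 1 < x] ->
    ~ [/\ a <= x, x < 1 & 1 < Num.min y z] ->
    cut p1 pc u1 c -> cut p2 pc u2 c -> cut p3 pc v1 c -> cut p4 pc v2 c ->
    cut p1 p2 u1 u2 -> cut p3 p4 v1 v2 ->
    cut p1 p4 u1 (x * v2) -> cut p1 p3 u1 (y * v1) ->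
    cut p2 p3 u2 (a * v1) -> cut p2 p4 u2 (z * v2) ->
  [/\ p1 = pc, p2 = pc, p3 = pc & p4 = pc].
Proof.
move=> ax ay az n1 n2 n3 c1 c2 c3 c4 c5 c6 c7 c8 c9 c10.
have ge0 := (ltW x_gt0, ltW y_gt0, ltW z_gt0, ltW a_gt0, ltW u1_gt0,
  ltW u2_gt0, ltW v1_gt0, ltW v2_gt0, ltW c_gt0, k_ge0).
have s1 : cut_signs p1 pc (y - 1) (x - 1) 0.
  by apply: (cut_signsP _ _ _ _ diff_u1_c c1); rewrite ?ge0.
have s2 : cut_signs p2 pc (a - 1) (z - 1) 0.
  by apply: (cut_signsP _ _ _ _ diff_u2_c c2); rewrite ?ge0.
have s3 : cut_signs p3 pc (1 - y) (1 - a) 0.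
  by apply: (cut_signsP _ _ _ _ diff_v1_c c3);
     rewrite ?mulr_gt0 ?mulr_ge0 ?ge0.
have s4 : cut_signs p4 pc (1 - x) (1 - z) 0.
  by apply: (cut_signsP _ _ _ _ diff_v2_c c4);
     rewrite ?mulr_gt0 ?mulr_ge0 ?ge0.
have s5 : cut_signs p1 p2 (y - a) (x - z) 0.
  by apply: (cut_signsP _ _ _ _ diff_u1_u2 c5); rewrite ?ge0.
have s6 : cut_signs p3 p4 (x - y) (z - a) 0.
  by apply: (cut_signsP _ _ _ _ diff_v1_v2 c6);
     rewrite ?mulr_gt0 ?mulr_ge0 ?ge0.
have s7 : cut_signs p1 p4 (z - x) (1 - x) (y - x).
  by apply: (cut_signsP _ _ _ _ diff_u1_v2 c7);
     rewrite ?mulr_gt0 ?mulr_ge0 ?ge0.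
have s8 : cut_signs p1 p3 (a - y) (1 - y) (x - y).
  by apply: (cut_signsP _ _ _ _ diff_u1_v1 c8);
     rewrite ?mulr_gt0 ?mulr_ge0 ?ge0.
have s9 : cut_signs p2 p3 (y - a) (1 - a) (z - a).
  by apply: (cut_signsP _ _ _ _ diff_u2_v1 c9);
     rewrite ?mulr_gt0 ?mulr_ge0 ?ge0.
have s10 : cut_signs p2 p4 (x - z) (1 - z) (a - z).
  by apply: (cut_signsP _ _ _ _ diff_u2_v2 c10);
     rewrite ?mulr_gt0 ?mulr_ge0 ?ge0.
have := cut_signs_cases ax ay az n1 n2 n3 s1 s2 s3 s4 s5 s6 s7 s8 s9 s10.
rewrite !inE => /or4P[/eqP[-> -> -> -> ->]|/eqP[-> -> -> -> ->]||] //.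
- move=> /eqP[? ? ? ? ?]; subst; exfalso.
  have y_gt1 : 1 < y by case: s3; lra.
  have x_lt1 : x < 1 by case: s1; lra.
  have zx : z < x by case: s7; lra.
  exact: no_cut_u1_u2_v1 c3 c7 c10.
- case/or3P => /eqP[? ? ? ? ?]; subst; exfalso.
  + have a_lt1 : a < 1 by case: s2; lra.
    have y_gt1 : 1 < y by case: s3; lra.
    have yx : y < x by case: s8; lra.
    have xz : x < z by case: s7; lra.
    exact: no_cut_u2_v1_v2 c3 c2 c8.
  + exact: u1_not_source c5 c1 c8 c7.
  + exact: v2_not_source c7 c10 c4 c6.
Qed.

End ReducedSystem.

(** * From cuts to efficiency *)

Lemma efficient_of_cuts {R : realType} {n : nat} (A : 'M[R]_n) (w : 'cV[R]_n) :
    positive_vector w ->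
    (forall P : pred 'I_n,
      (forall i j, P i -> ~~ P j -> w i 0 < A i j * w j 0) ->
      forall i j, P i = P j) ->
  efficient A w.
Proof.
move=> w_gt0 cutP; split=> // -[w' [w'_gt0 w'_le [i0 [j0 w'_lt]]]].
pose q i := w' i 0 / w i 0.
(* Along an edge [w i 0 / w j 0] is at least [A i j], so a no larger error bounds [w' i 0 / w' j 0]
   by it. *)
have q_mono i j : A i j * w j 0 <= w i 0 -> q i <= q j.
  move=> edge; have := w'_le i j.
  rewrite [`|_ - w i 0 / _|]ler0_norm ?subr_le0 ?ler_pdivlMr // opprB.
  rewrite ler_norml opprB => /andP[+ _]; rewrite lerD2l lerN2 /q.
  rewrite !ler_pdivrMr // ![_ / _ * _]mulrAC !ler_pdivlMr //.
  by rewrite ler_pdivrMr // [w' j 0 * _]mulrC.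
(* No edge leaves the level set where [q] exceeds [q j], so this set, which misses [j], is empty. *)
have q_le i j : q i <= q j.
  rewrite leNgt -(cutP (fun l => q j < q l) _ j i) ?ltxx //.
  move=> s t ts; rewrite -leNgt => tj; rewrite ltNge; apply/negP => /q_mono st.
  by have := lt_le_trans ts (le_trans st tj); rewrite ltxx.
have qE i j : w' i 0 / w' j 0 = w i 0 / w j 0.
  have /eqP : q i = q j by apply/eqP; rewrite eq_le !q_le.
  rewrite /q eqr_div ?lt0r_neq0 // => /eqP eqw.
  by apply/eqP; rewrite eqr_div ?lt0r_neq0 // eqw mulrC.
by rewrite qE ltxx in w'_lt.
Qed.

(** * Reduction of the full matrix to five classes of indices *)

Theorem theorem10 (R : realType) (n : nat) (x y z a : R)
  (n_ge5 : (5 <= n)%N)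
  (x_gt0 : 0 < x) (y_gt0 : 0 < y) (z_gt0 : 0 < z) (a_gt0 : 0 < a)
  (a_min : a <= Num.min x (Num.min y z))
  (not_i : ~ [/\ a < y, y < x, x < z & y < 1])
  (not_ii : ~ [/\ a < z, z < x, x < y & 1 < x])
  (not_iii : ~ [/\ a <= x, x < 1 & 1 < Num.min y z])
  (w : 'cV[R]_n) (w_perron : perron_eigenvector (Zmx n x y z a) w) :
  efficient (Zmx n x y z a) w.
Proof.
move: a_min; rewrite !le_min => /and3P[ax ay az].
case: n n_ge5 w w_perron => [|[|[|[|[|m]]]]] // _ w [w_gt0 [r _ eqw] _].
set Z := Zmx _ _ _ _ _ in eqw *.
(* Indices are 0-based and [n = m + 5]: [i3] and [i4] are the last two, [i0] represents the middle
   ones. *)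
pose i1 := @Ordinal m.+4.+1 0 isT; pose i2 := @Ordinal m.+4.+1 1 isT.
pose i0 := @Ordinal m.+4.+1 2 isT.
pose i3 := @Ordinal m.+4.+1 m.+3 (leqnSn m.+4).
pose i4 := @Ordinal m.+4.+1 m.+4 (leqnn m.+4.+1).
pose mid (j : 'I_m.+4.+1) := (1 < j < m.+3)%N.
have midP j : [\/ mid j, j = i1, j = i2 | j = i3 \/ j = i4].
  have [->|n1] := eqVneq j i1; first by constructor 2.
  have [->|n2] := eqVneq j i2; first by constructor 3.
  have [->|n3] := eqVneq j i3; first by constructor 4; left.
  have [->|n4] := eqVneq j i4; first by constructor 4; right.
  constructor 1; move: n1 n2 n3 n4; rewrite -!val_eqE /mid /=.
  by have := ltn_ord j; lia.
(* The entries outside the two off-diagonal 2 by 2 corners. *)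
have Z1 (i j : 'I_m.+4.+1) :
    ((1 < i)%N || (j < m.+3)%N) -> ((i < m.+3)%N || (1 < j)%N) -> Z i j = 1.
  move=> h1 h2; rewrite mxE /= !xpair_eqE /=.
  by do 8 (case: ifP => [|_]; first by lia).
have Z13 : Z i1 i3 = y by rewrite mxE /= !xpair_eqE /= eqxx.
have Z14 : Z i1 i4 = x.
  by rewrite mxE /= !xpair_eqE /=; do ![case: ifP => //]; lia.
have Z23 : Z i2 i3 = a.
  by rewrite mxE /= !xpair_eqE /=; do ![case: ifP => //]; lia.
have Z24 : Z i2 i4 = z.
  by rewrite mxE /= !xpair_eqE /=; do ![case: ifP => //]; lia.
have Z31 : Z i3 i1 = y^-1.
  by rewrite mxE /= !xpair_eqE /=; do ![case: ifP => //]; lia.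
have Z41 : Z i4 i1 = x^-1.
  by rewrite mxE /= !xpair_eqE /=; do ![case: ifP => //]; lia.
have Z32 : Z i3 i2 = a^-1.
  by rewrite mxE /= !xpair_eqE /=; do ![case: ifP => //]; lia.
have Z42 : Z i4 i2 = z^-1.
  by rewrite mxE /= !xpair_eqE /=; do ![case: ifP => //]; lia.
have sumE (F : 'I_m.+4.+1 -> R) :
    \sum_j F j = F i1 + F i2 + F i3 + F i4 + \sum_(j | mid j) F j.
  have D1 (Q : pred 'I_m.+4.+1) i :
      Q i -> \sum_(j | Q j) F j = F i + \sum_(j | Q j && (j != i)) F j.
    exact: bigD1.
  rewrite (D1 xpredT i1) // (D1 _ i2) // (D1 _ i3) // (D1 _ i4) /=; last first.
    by rewrite -!val_eqE /=; lia.
  rewrite !addrA.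
  congr (_ + _); apply: eq_bigl => j; rewrite -!val_eqE /mid /=.
  by have := ltn_ord j; lia.
have row i : r * w i 0 = \sum_j Z i j * w j 0.
  by have /matrixP/(_ i 0) := eqw; rewrite !mxE.
have r_gt0 : 0 < r.
  rewrite -(pmulr_lgt0 _ (w_gt0 i0)) row sumE.
  rewrite !Z1 // !mul1r ltr_wpDr ?addr_gt0 //.
  by apply: sumr_ge0 => j /andP[j1 j2]; rewrite Z1 ?j1 ?j2 ?mul1r ?ltW.
(* Middle rows consist of ones only, hence have the same product with [w]. *)
have w_mid j : mid j -> w j 0 = w i0 0.
  move=> /andP[j1 j2]; apply: (mulfI (lt0r_neq0 r_gt0)); rewrite !row.
  by apply: eq_bigr => l _; rewrite !Z1 ?j1 ?j2.
pose k : R := #|mid|%:R.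
have sum_mid i : \sum_(j | mid j) Z i j * w j 0 = k * w i0 0.
  rewrite /k mulr_natl -sumr_const; apply: eq_bigr => j mid_j.
  case/andP: (mid_j) => j1 j2.
  by rewrite w_mid // Z1 ?mul1r ?j1 ?j2 ?orbT.
have eqs i : r * w i 0 = Z i i1 * w i1 0 + Z i i2 * w i2 0 + Z i i3 * w i3 0
    + Z i i4 * w i4 0 + k * w i0 0.
  by rewrite row sumE sum_mid.
apply: efficient_of_cuts => // P cutP.
(* Reciprocity turns the condition at [(j, i)] into the reverse inequality at [(i, j)]. *)
have cut_pair i j e : 0 < e -> Z i j = e -> Z j i = e^-1 ->
    cut (P i) (P j) (w i 0) (e * w j 0).
  move=> e_gt0 Zij Zji; have := cutP i j; have := cutP j i.
  case: (P i); case: (P j) => //=.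
    by move=> _; rewrite Zij; apply.
  by move=> + _; rewrite Zji mulrC ltr_pdivlMr // mulrC; apply.
have cut1 i j : Z i j = 1 -> Z j i = 1 -> cut (P i) (P j) (w i 0) (w j 0).
  by move=> Zij Zji; rewrite -[w j 0]mul1r; apply: cut_pair; rewrite ?invr1.
(* Separating two middle indices would require a strict inequality between equal components. *)
have P_mid j : mid j -> P j = P i0.
  move=> mid_j; have := cut1 j i0; rewrite w_mid //.
  case/andP: mid_j => j1 j2; rewrite !Z1 ?j1 ?j2 ?orbT // => /(_ erefl erefl).
  by case: (P j); case: (P i0) => //=; rewrite ltxx.
have [P1 P2 P3 P4] : [/\ P i1 = P i0, P i2 = P i0, P i3 = P i0 & P i4 = P i0].
{ apply: (@cut_trivial _ x y z a k r
      (w i1 0) (w i2 0) (w i0 0) (w i3 0) (w i4 0)); rewrite ?ler0n //.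
  - by rewrite eqs Z13 Z14 !Z1 ?orbT //; ring.
  - by rewrite eqs Z23 Z24 !Z1 ?orbT //; ring.
  - by rewrite eqs !Z1 ?orbT //; ring.
  - by rewrite eqs Z31 Z32 !Z1 ?orbT //; ring.
  - by rewrite eqs Z41 Z42 !Z1 ?orbT //; ring.
  all: by first [by apply: cut_pair | apply: cut1; rewrite Z1 ?orbT]. }
have Pi0 j : P j = P i0 by case: (midP j) => [/P_mid|->|->|[->|->]].
by move=> i j; rewrite !Pi0.
Qed.
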